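(* Let $n\ge1$ and ${\bf m}=(m_1,\ldots,m_n)$ be a vector of positive integers with $m_1+\cdots+m_n=m$. Then, as formal power series in $t$, $$\frac{\sum_{\pi\in P^{\pm}({\bf m})}t^{\operatorname{des}(\pi)}q^{\operatorname{fmaj}(\pi)}z^{N(\pi)}}{(t;q^2)_{m+1}}=\sum_{k\geq0}\prod_{r=1}^n\left(\sum_{i=0}^{m_r}(zq)^i{m_r-i+k\brack m_r-i}_{q^2}{i+k-1\brack i}_{q^2}\right)t^k.$$
   Context: $P^{\pm}({\bf m})$ is the set of signed permutations of the multiset $M_{\bf m}=\{1^{m_1},2^{m_2},\ldots,n^{m_n}\}$: words $\pi=\pi_1\cdots\pi_m$ of nonzero integers such that $|\pi_1|\cdots|\pi_m|$ is an arrangement of $M_{\bf m}$, each entry carrying an arbitrary sign. A descent of $\pi$ is an index $i\in\{0,\ldots,m-1\}$ with $\pi_i>\pi_{i+1}$, where $\pi_0=0$; $\operatorname{DES}(\pi)$ is the set of descents, $\operatorname{des}(\pi)=|\operatorname{DES}(\pi)|$, $\operatorname{maj}(\pi)=\sum_{i\in\operatorname{DES}(\pi)}i$, $N(\pi)$ is the number of negative entries of $\pi$, and $\operatorname{fmaj}(\pi)=2\operatorname{maj}(\pi)+N(\pi)$. The $q$-shifted factorial is $(t;q)_n=\prod_{i=0}^{n-1}(1-tq^i)$, $(t;q)_0=1$, and ${a\brack b}_q=\frac{(q;q)_a}{(q;q)_{a-b}(q;q)_b}$ for $0\le b\le a$, with the conventions ${a\brack b}_q=0$ if $0\le a<b$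 and ${-1\brack 0}_q=1$. *)

(* Defs.v *)
From HB Require Import structures.
From mathcomp Require Import all_boot all_order all_algebra.
From mathcomp Require Import mpoly.

Set Implicit Arguments.
Unset Strict Implicit.
Unset Printing Implicit Defensive.

Import Order.TTheory GRing.Theory Num.Theory.
Local Open Scope ring_scope.

(* Signed words.  The letter (r, s) of 'I_n * bool stands for the nonzero     *)
(* integer r + 1 if s = false and - (r + 1) if s = true, so that words over   *)
(* 'I_n * bool are exactly the words of nonzero integers of absolute value at *)
(* most n; accordingly mu r is the multiplicity m_(r+1).                      *)

Definition letter_int (n : nat) (x : 'I_n * bool) : int :=
  (-1) ^+ x.2 * (x.1.+1)%:Z.

Definition word_int (n : nat) (w : seq ('I_n * bool)) : seq int :=
  map (@letter_int n) w.

Definition signed_perms (n : nat) (mu : 'I_n -> nat) (m : nat) :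
    {set m.-tuple ('I_n * bool)} :=
  [set w : m.-tuple _ |
    [forall r : 'I_n, count (fun x : 'I_n * bool => x.1 == r) w == mu r]].

(* nth 0 (0 :: p) i is p_i in the 1-based indexing, with p_0 = 0.             *)
Definition DES (p : seq int) : seq nat :=
  [seq i <- iota 0 (size p) | nth 0 (0 :: p) i > nth 0 (0 :: p) i.+1].

Definition des (p : seq int) : nat := size (DES p).

Definition maj (p : seq int) : nat := (\sum_(i <- DES p) i)%N.

Definition negs (p : seq int) : nat := count (fun x => x < 0) p.

Definition fmaj (p : seq int) : nat := (2 * maj p + negs p)%N.

Definition qpoch (R : comNzRingType) (t q : R) (n : nat) : R :=
  \prod_(i < n) (1 - t * q ^+ i).

(* The upper index is an integer because of the convention [-1, 0] = 1; the   *)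
(* value 0 at the remaining negative upper indices is a dummy.                *)
Definition qbinom (F : fieldType) (q : F) (a : int) (b : nat) : F :=
  match a with
  | Posz a' =>
      if (b <= a')%N
      then qpoch q q a' / (qpoch q q (a' - b) * qpoch q q b)
      else 0
  | Negz 0 => if b == 0%N then 1 else 0
  | Negz _ => 0
  end.

(* Formal power series in t, given by their coefficients.                     *)
Section FormalPowerSeries.

Variable F : fieldType.

Definition fps : Type := nat -> F.

Definition fps_one : fps := fun k => (k == 0%N)%:R.

Definition fps_mul (f g : fps) : fps :=
  fun k => \sum_(i < k.+1) f i * g (k - i)%N.

Definition fps_poly (p : {poly F}) : fps := fun k => p`_k.

Fixpoint fps_inv_seq (f : fps) (k : nat) : seq F :=
  if k is k'.+1 then
    let s := fps_inv_seq f k' in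
    rcons s ((f 0%N)^-1 * ((k' == 0%N)%:R - \sum_(i < k') f (k' - i)%N * s`_i))
  else [::].

(* The multiplicative inverse of f when f 0 != 0 (see fps_mulV).              *)
Definition fps_inv (f : fps) : fps := fun k => (fps_inv_seq f k.+1)`_k.

Definition fps_div (f g : fps) : fps := fps_mul f (fps_inv g).

Lemma size_fps_inv_seq f k : size (fps_inv_seq f k) = k.
Proof. by elim: k => //= k IHk; rewrite size_rcons IHk. Qed.

Lemma nth_fps_inv_seq f k i : (i < k)%N -> (fps_inv_seq f k)`_i = fps_inv f i.
Proof.
elim: k => // k IHk; rewrite ltnS leq_eqVlt => /predU1P[-> //| ltik].
by rewrite /= nth_rcons size_fps_inv_seq ltik IHk.
Qed.

Lemma fps_invE f k :
  fps_inv f k =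
  (f 0%N)^-1 * ((k == 0%N)%:R - \sum_(i < k) f (k - i)%N * fps_inv f i).
Proof.
rewrite {1}/fps_inv /= nth_rcons size_fps_inv_seq ltnn eqxx.
by under eq_bigr => i _ do rewrite nth_fps_inv_seq //.
Qed.

Lemma fps_mulV f : f 0%N != 0 -> fps_mul f (fps_inv f) =1 fps_one.
Proof.
move=> f0 k; rewrite /fps_mul (reindex_inj rev_ord_inj) big_ord_recr /=.
rewrite subSS subnn subn0 [X in f 0%N * X]fps_invE mulrA divff // mul1r.
rewrite addrC; under [X in _ + X]eq_bigr => i _ do
  rewrite subSS subKn ?(ltnW (ltn_ord i)) //.
by rewrite subrK.
Qed.

End FormalPowerSeries.

(* The field Q(q, z) of rational functions in two indeterminates.             *)
Notation Qqz := {fraction {mpoly rat[2]}}.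

Definition q : Qqz := tofrac ('X_0 : {mpoly rat[2]}).
Definition z : Qqz := tofrac ('X_1 : {mpoly rat[2]}).

(* Main.v *)
(* Put Q = q^2 and y = z q, so that the weight of a word w is                  *)
(* t^des Q^maj y^N.  Divided by (t; Q)_(m+1) it becomes the generating         *)
(* function, over k, of the sequences k = s_0 >= s_1 >= ... >= s_m >= 0 with   *)
(* s_i > s_(i+1) at every descent i of w, weighted by Q^(s_1 + ... + s_m) y^N. *)
(* A pair (w, s) is a sequence of pairs (s_i, w_i) sorted by decreasing s and, *)
(* for equal s, increasing letter, so it amounts to a multiset of pairs; the   *)
(* level s = k is closed to the negative letters because of w_0 = 0.  Hence    *)
(* the sum over all w factors over the absolute values r: the positive letters *)
(* contribute a complete homogeneous polynomial in 1, ..., Q^k and the         *)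
(* negative ones a complete homogeneous polynomial in 1, ..., Q^(k-1).         *)
Require Import Defs.
From HB Require Import structures.
From mathcomp Require Import all_boot all_order all_algebra.
From mathcomp Require Import mpoly zify ring.

Set Implicit Arguments.
Unset Strict Implicit.
Unset Printing Implicit Defensive.

Import Order.TTheory GRing.Theory Num.Theory.
Local Open Scope ring_scope.

Lemma fps_mul_trunc (F : fieldType) (f g : fps F) K k : (k < K)%N ->
  fps_mul f g k = ((\poly_(i < K) f i) * (\poly_(i < K) g i))`_k.
Proof.
move=> ltkK; rewrite coefM; apply: eq_bigr => i _; rewrite !coef_poly.
have leik : (i <= k)%N by rewrite -ltnS.
by rewrite (leq_ltn_trans leik ltkK) (leq_ltn_trans (leq_subr _ _) ltkK).
Qed.

Lemma fps_mulC (F : fieldType) (f g : fps F) : fps_mul f g =1 fps_mul g f.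
Proof. by move=> k; rewrite !(@fps_mul_trunc _ _ _ k.+1) // mulrC. Qed.

Lemma fps_mulA (F : fieldType) (f g h : fps F) :
  fps_mul f (fps_mul g h) =1 fps_mul (fps_mul f g) h.
Proof.
have trunc (a b c : fps F) k : fps_mul a (fps_mul b c) k =
    ((\poly_(i < k.+1) a i) * ((\poly_(i < k.+1) b i) * (\poly_(i < k.+1) c i)))`_k.
  rewrite coefM; apply: eq_bigr => i _.
  by rewrite coef_poly ltn_ord -fps_mul_trunc // ltnS leq_subr.
by move=> k; rewrite [RHS]fps_mulC !trunc mulrA mulrC.
Qed.

Lemma eq_fps_mul (F : fieldType) (f f' g g' : fps F) :
  f =1 f' -> g =1 g' -> fps_mul f g =1 fps_mul f' g'.
Proof. by move=> ff' gg' k; apply: eq_bigr => i _; rewrite ff' gg'. Qed.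

Lemma fps_mul1 (F : fieldType) (f : fps F) : fps_mul (@fps_one F) f =1 f.
Proof.
move=> k; rewrite /fps_mul big_ord_recl big1 ?addr0 ?subn0 ?mul1r // => i _.
by rewrite /fps_one /= mul0r.
Qed.

Lemma fps_div_unique (F : fieldType) (f g h : fps F) :
  g 0%N != 0 -> fps_mul g h =1 f -> fps_div f g =1 h.
Proof.
move=> g0 ghf k; rewrite /fps_div fps_mulC.
rewrite -(eq_fps_mul (frefl _) ghf) fps_mulA.
rewrite (eq_fps_mul (g' := h) (f' := @fps_one F)) ?fps_mul1 // => j.
by rewrite fps_mulC fps_mulV.
Qed.

Lemma fps_polyM (F : fieldType) (p r : {poly F}) (f : fps F) :
  fps_mul (fps_poly (p * r)) f =1 fps_mul (fps_poly p) (fps_mul (fps_poly r) f).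
Proof. by move=> k; rewrite fps_mulA; apply: eq_fps_mul => // j; rewrite /fps_poly coefM. Qed.

Lemma fps_mul_linear (F : fieldType) (c : F) (f : fps F) k :
  fps_mul (fps_poly (1 - c *: 'X)) f k = f k - (if k is k'.+1 then c * f k' else 0).
Proof.
rewrite /fps_mul big_ord_recl subn0 /fps_poly coefB coefZ coefX coef1 mulr0 subr0 mul1r.
congr (_ + _); case: k => [|k]; first by rewrite big_ord0 oppr0.
rewrite big_ord_recl big1 /= => [|i _].
  by rewrite coefB coefZ coefX coef1 /= subSS subn0; ring.
by rewrite coefB coefZ coefX coef1 /= mulr0 subr0 mul0r.
Qed.

Lemma fps_mul_sumr (F : fieldType) (f : fps F) (I : finType) (P : pred I) (g : I -> fps F) :
  fps_mul f (fun k => \sum_(i | P i) g i k) =1 fun k => \sum_(i | P i) fps_mul f (g i) k.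
Proof.
move=> k; rewrite /fps_mul exchange_big; apply: eq_bigr => j _.
by rewrite mulr_sumr.
Qed.

(** * The q-shifted factorial as a polynomial in t *)

Section QPochhammer.
Variables (F : fieldType) (Q : F).

Lemma qpoch_XE a m :
  qpoch (a *: 'X) Q%:P m = \prod_(i < m) (1 - (a * Q ^+ i) *: 'X).
Proof.
apply: eq_bigr => i _; congr (_ - _).
by rewrite -rmorphXn /= mulrC mul_polyC scalerA mulrC.
Qed.

Lemma qpoch_X m : qpoch 'X Q%:P m = \prod_(i < m) (1 - Q ^+ i *: 'X).
Proof.
rewrite -[in LHS](scale1r 'X) qpoch_XE.
by apply: eq_bigr => i _; rewrite mul1r.
Qed.

Lemma qpoch_XS m :
  qpoch 'X Q%:P m.+1 = qpoch (Q *: 'X) Q%:P m * (1 - 1 *: 'X).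
Proof.
rewrite qpoch_X qpoch_XE big_ord_recl mulrC expr0.
congr (_ * _); apply: eq_bigr => i _; by rewrite exprS.
Qed.

(** This is the substitution t -> Qt, checked on one linear factor at a time. *)
Lemma fps_qpoch_dilate m (f g : fps F) :
  fps_mul (fps_poly (qpoch 'X Q%:P m)) f =1 g ->
  fps_mul (fps_poly (qpoch (Q *: 'X) Q%:P m)) (fun k => Q ^+ k * f k)
    =1 fun k => Q ^+ k * g k.
Proof.
rewrite qpoch_X qpoch_XE.
elim: m f g => [|m IHm] f g fg.
  have one (u : fps F) : fps_mul (fps_poly 1) u =1 u.
    by move=> j; rewrite -[RHS]fps_mul1; apply: eq_fps_mul => // i; rewrite /fps_poly coef1.
  by move=> k; rewrite -fg !big_ord0 !one.
rewrite !big_ord_recr /= in fg *.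
have fg' : fps_mul (fps_poly (\prod_(i < m) (1 - Q ^+ i *: 'X)))
   (fps_mul (fps_poly (1 - Q ^+ m *: 'X)) f) =1 g.
  by move=> k; rewrite -fps_polyM.
move=> k; rewrite fps_polyM -(IHm _ _ fg'); apply: eq_fps_mul => // j.
rewrite !fps_mul_linear; case: j => [|j]; rewrite ?subr0 //.
by rewrite !exprS; ring.
Qed.

Lemma qpoch_X_coef0 m : (qpoch 'X Q%:P m)`_0 = 1.
Proof.
rewrite -horner_coef0 qpoch_X horner_prod big1 // => i _.
by rewrite hornerD hornerN hornerZ hornerX mulr0 oppr0 addr0 hornerC.
Qed.

End QPochhammer.

(* The complete homogeneous symmetric polynomial of degree d at 1, ..., Q^(k-1), *)
(* expanded along its last variable.                                             *)
Fixpoint qhom (R : comNzRingType) (Q : R) (d k : nat) : R :=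
  if d is d'.+1 then \sum_(j < k) Q ^+ j * qhom Q d' j.+1 else 1.

(** The complete homogeneous polynomial of degree d in the variables 1, ..., Q^(k-1) and y, yQ, ...,
    yQ^(k'-1) together; the two step lemmas below expand it along the last variable of either
    kind. *)
Definition signed_qhom (R : comNzRingType) (Q y : R) (d k k' : nat) : R :=
  \sum_(i < d.+1) y ^+ i * qhom Q (d - i) k * qhom Q i k'.

(** * Complete homogeneous polynomials and Gaussian binomials *)

Section CompleteHomogeneous.
Variables (R : comNzRingType) (Q y : R).

Lemma qhomS d k : qhom Q d.+1 k.+1 = qhom Q d.+1 k + Q ^+ k * qhom Q d k.+1.
Proof. by rewrite /= big_ord_recr. Qed.

Lemma signed_qhom0 k k' : signed_qhom Q y 0 k k' = 1.
Proof. by rewrite /signed_qhom big_ord1 /= !mulr1. Qed.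

Lemma signed_qhom00 d : signed_qhom Q y d.+1 0 0 = 0.
Proof.
rewrite /signed_qhom big1 // => -[[|i] ltid] _ /=; first by rewrite big_ord0 mulr0 mul0r.
by rewrite big_ord0 mulr0.
Qed.

Lemma signed_qhom_stepl d k k' :
  signed_qhom Q y d.+1 k.+1 k' =
  signed_qhom Q y d.+1 k k' + Q ^+ k * signed_qhom Q y d k.+1 k'.
Proof.
rewrite /signed_qhom big_ord_recr [in RHS]big_ord_recr subnn -addrA [X in _ + X]addrC addrA.
congr (_ + _); rewrite mulr_sumr -big_split; apply: eq_bigr => i _.
have leid : (i <= d)%N by rewrite -ltnS.
by rewrite /= subSn // qhomS; ring.
Qed.

Lemma signed_qhom_stepr d k k' :
  signed_qhom Q y d.+1 k k'.+1 =
  signed_qhom Q y d.+1 k k' + y * Q ^+ k' * signed_qhom Q y d k k'.+1.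
Proof.
rewrite /signed_qhom big_ord_recl [in RHS]big_ord_recl -addrA; congr (_ + _).
rewrite mulr_sumr -big_split; apply: eq_bigr => i _.
by rewrite lift0 subSS qhomS exprS mulrDr; congr (_ + _); ring.
Qed.

End CompleteHomogeneous.

(** The recursion [qhomS] is the q-Pascal rule; the hypothesis on Q keeps all denominators
    nonzero. *)
Lemma qhom_qbinom (F : fieldType) (Q : F) d k :
  (forall i, Q ^+ i.+1 != 1) -> qbinom Q (Posz (d + k)) d = qhom Q d k.+1.
Proof.
move=> nQ.
have poch_neq0 i : qpoch Q Q i != 0.
  by apply/prodf_neq0 => j _; rewrite -exprS subr_eq0 eq_sym.
have pochS i : qpoch Q Q i.+1 = qpoch Q Q i * (1 - Q ^+ i.+1).
  by rewrite /qpoch big_ord_recr -exprS.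
have n1 i : 1 - Q ^+ i.+1 != 0 by rewrite subr_eq0 eq_sym.
rewrite /qbinom leq_addr addKn.
elim: d k => [|d IHd] k; first by rewrite /= [qpoch _ _ 0]big_ord0 mulr1 divff.
elim: k => [|k IHk].
  by rewrite addn0 qhomS /= big_ord0 add0r mul1r -IHd addn0 [qpoch _ _ 0]big_ord0 !mul1r !divff.
rewrite qhomS -IHk -IHd addSnnS !addnS addSn (pochS (d + k).+1) (pochS d) (pochS k).
have -> : Q ^+ (d + k).+2 = Q ^+ d.+1 * Q ^+ k.+1 by rewrite -exprD addSn addnS.
field.
by rewrite !poch_neq0 !n1.
Qed.

(** * Descents after an arbitrary initial value, and the order on letters *)

Definition DES_from (a : int) (p : seq int) : seq nat :=
  [seq i <- iota 0 (size p) | nth 0 (a :: p) i > nth 0 (a :: p) i.+1].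

Lemma DES_from_cons a x p :
  DES_from a (x :: p) = nseq (x < a)%R 0%N ++ map succn (DES_from x p).
Proof.
rewrite /DES_from [LHS]/= (iotaDl 1 0) filter_map.
by rewrite -[map (addn 1) _]/(map succn _); case: (x < a).
Qed.

Lemma size_DES_from_cons a x p :
  size (DES_from a (x :: p)) = ((x < a)%R + size (DES_from x p))%N.
Proof. by rewrite DES_from_cons size_cat size_nseq size_map. Qed.

(** A new first letter moves every descent of the tail one place to the right, and a descent at
    position 0 adds nothing. The resulting factor Q^des of the tail is the one produced by t ->
    Qt. *)
Lemma sum_DES_from_cons a x p :
  (\sum_(i <- DES_from a (x :: p)) i =
   \sum_(i <- DES_from x p) i + size (DES_from x p))%N.
Proof.
rewrite DES_from_cons big_cat big_map /= [X in (X + _)%N](_ : _ = 0%N).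
  by under eq_bigr => i _ do rewrite -addn1; rewrite big_split sum1_size.
by rewrite big_nseq; case: (x < a).
Qed.

(* Rank of a letter in the decreasing order n, ..., 1, -1, ..., -n. *)
Definition letter_rank (n : nat) (x : 'I_n * bool) : nat :=
  if x.2 then (n + x.1)%N else (n - x.1.+1)%N.

Section LetterRank.
Variable n : nat.
Implicit Types x a : 'I_n * bool.

Lemma letter_rank_inj : injective (@letter_rank n).
Proof.
move=> [r b] [s c]; rewrite /letter_rank /=.
have := ltn_ord r; have := ltn_ord s.
by case: b; case: c => ? ? ?; congr (_, _); try (apply: val_inj => /=); lia.
Qed.

Lemma letter_rank_surj p : (p < n + n)%N -> exists x : 'I_n * bool, letter_rank x = p.
Proof.
move=> ltp; case: (ltnP p n) => [ltpn | lenp].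
  have lt1 : (n - p.+1 < n)%N by lia.
  by exists (Ordinal lt1, false); rewrite /letter_rank /=; lia.
have lt1 : (p - n < n)%N by lia.
by exists (Ordinal lt1, true); rewrite /letter_rank /=; lia.
Qed.

Lemma letter_rank_bound x : (letter_rank x < n + n)%N.
Proof. by case: x => r []; rewrite /letter_rank /=; have := ltn_ord r; lia. Qed.

Lemma letter_int_lt0 x : (letter_int x < 0) = x.2.
Proof. by case: x => r []; rewrite /letter_int /=; lia. Qed.

Lemma letter_rank_lt_n x : (letter_rank x < n)%N = ~~ (letter_int x < 0).
Proof.
rewrite letter_int_lt0; case: x => r []; rewrite /letter_rank /=; have := ltn_ord r; lia.
Qed.

Lemma letter_rank_le x a :
  (letter_rank x <= letter_rank a)%N = ~~ (letter_int x < letter_int a).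
Proof.
case: x a => r b [s c]; rewrite /letter_int /letter_rank /=.
have := ltn_ord r; have := ltn_ord s.
case: b; case: c => /= ? ?; rewrite ?expr1 ?expr0 ?mulN1r ?mul1r; lia.
Qed.

End LetterRank.

(* Sum of Q^(s_1 + ... + s_m) y^N over the s for which (s_1, w_1), ...,        *)
(* (s_m, w_m) is sorted by decreasing s and then increasing letter, where the  *)
(* pairs at level k may only use letters of rank less than p.  The initial     *)
(* condition w_0 = 0 is p = n, and a preceding letter a is p = rank a + 1.     *)
Fixpoint chain_sum (R : comNzRingType) (Q y : R) (n : nat) (k p : nat)
    (w : seq ('I_n * bool)) : R :=
  if w is x :: w' then
    \sum_(s < k + (letter_rank x < p))
       y ^+ x.2 * Q ^+ s * chain_sum Q y s (letter_rank x).+1 w'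
  else 1.

(** * The series of a single word *)

Section ChainSeries.
Variables (F : fieldType) (Q y : F) (n : nat).

Lemma chain_series (a : int) (p : nat) (w : seq ('I_n * bool)) :
    (forall x : 'I_n * bool, (letter_rank x < p)%N = ~~ (letter_int x < a)) ->
  fps_mul (fps_poly (qpoch 'X Q%:P (size w).+1)) (fun k => chain_sum Q y k p w)
  =1 fps_poly ((Q ^+ (\sum_(i <- DES_from a (word_int w)) i)%N * y ^+ negs (word_int w))
               *: 'X^(size (DES_from a (word_int w)))).
Proof.
elim: w a p => [|x w IHw] a p pa k.
  rewrite /= big_nil expr0 mul1r scale1r qpoch_X big_ord_recl big_ord0 mulr1 expr0.
  by rewrite fps_mul_linear /fps_poly coef1; case: k => [|k] /=; rewrite ?subr0 ?mul1r ?subrr.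
rewrite [size _]/= qpoch_XS fps_polyM.
have IH := fps_qpoch_dilate (IHw (letter_int x) (letter_rank x).+1 (fun u => letter_rank_le u x)).
rewrite [word_int _]/= size_DES_from_cons sum_DES_from_cons.
(* The factor 1 - t telescopes the sum over the first level s: the term s = k survives if there is
   no descent, and s = k - 1 if there is one, whence a factor t. *)
have step : fps_mul (fps_poly (1 - 1 *: 'X)) (fun k => chain_sum Q y k p (x :: w)) =1
  fps_mul (fps_poly (y ^+ x.2 *: 'X^((letter_int x < a)%R)))
    (fun k => Q ^+ k * chain_sum Q y k (letter_rank x).+1 w).
  move=> j; rewrite fps_mul_linear /= pa; case: (letter_int x < a) => /=.
    rewrite addn0 /fps_mul; case: j => [|j].
      by rewrite big_ord0 big_ord1 /fps_poly coefZ coefX mulr0 mul0r subr0.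
    rewrite !addn0 big_ord_recr mul1r /= [LHS]addrAC subrr add0r.
    rewrite big_ord_recl big_ord_recl big1 => [|i _]; rewrite /fps_poly coefZ coefX.
      by rewrite mulr0 mul0r add0r coefZ coefX mulr1 addr0 /= subSS subn0 mulrA.
    by rewrite mulr0 mul0r.
  rewrite /fps_mul addn1 big_ord_recr big_ord_recl [X in _ = _ + X]big1 /= => [|i _]; last first.
    by rewrite /fps_poly coefZ coef1 mulr0 mul0r.
  rewrite /fps_poly coefZ coef1 mulr1 addr0 subn0 mulrA addrAC.
  by case: j => [|j]; rewrite ?big_ord0 ?addn1 ?mul1r ?subr0 ?subrr add0r.
rewrite (eq_fps_mul (frefl _) step) fps_mulA (eq_fps_mul (fps_mulC _ _) (frefl _)).
rewrite -fps_mulA (eq_fps_mul (frefl _) IH).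
set d := size _; set M := bigop _ _ _; set N := negs _.
have -> : negs (letter_int x :: word_int w) = (x.2 + N)%N by rewrite /negs /= letter_int_lt0.
rewrite (eq_fps_mul (g' := fps_poly ((Q ^+ d * (Q ^+ M * y ^+ N)) *: 'X^d)) (frefl _)).
  transitivity (fps_poly ((y ^+ x.2 *: 'X^((letter_int x < a)%R)) *
     ((Q ^+ d * (Q ^+ M * y ^+ N)) *: 'X^d)) k); first by rewrite /fps_poly coefM.
  by congr (fps_poly _ k); rewrite -scalerAl -scalerAr -exprD scalerA !exprD; congr (_ *: _); ring.
move=> j; rewrite /fps_poly !coefZ coefXn; case: eqP => [-> | _]; last by rewrite !mulr0.
by rewrite !mulr1.
Qed.

End ChainSeries.

(** * The sum over all words *)

Definition decr (n : nat) (mu : 'I_n -> nat) (r : 'I_n) : 'I_n -> nat :=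
  fun s => (mu s - (s == r))%N.

Lemma big_tuple_cons (R : nmodType) (T : finType) m (P : pred (m.+1.-tuple T))
    (f : m.+1.-tuple T -> R) :
  \sum_(w | P w) f w = \sum_x \sum_(w : m.-tuple T | P [tuple of x :: w]) f [tuple of x :: w].
Proof.
rewrite pair_big_dep /=.
rewrite (reindex (fun u : T * m.-tuple T => [tuple of u.1 :: u.2])) /=; first exact: eq_bigl.
exists (fun w => (thead w, [tuple of behead w])) => [[x w] _ | w _] /=.
  by congr (_, _); apply: val_inj.
by rewrite -tuple_eta.
Qed.

Lemma signed_perms_cons n (mu : 'I_n -> nat) m (x : 'I_n * bool) (w : m.-tuple ('I_n * bool)) :
  ([tuple of x :: w] \in signed_perms mu m.+1) =
  (0 < mu x.1)%N && (w \in signed_perms (decr mu x.1) m).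
Proof.
rewrite !inE; apply/forallP/andP => [h | [mux /forallP h] r].
  split; first by have /eqP <- := h x.1; rewrite /= eqxx.
  apply/forallP => r; have /eqP /= hr := h r.
  by rewrite /decr -hr (eq_sym r) addKn.
have /eqP /= -> := h r; rewrite /decr (eq_sym r).
by case: (x.1 =P r) => [<- | _] /=; rewrite ?subn0 // subnKC.
Qed.

Lemma sum_decr n (mu : 'I_n -> nat) r m :
  (0 < mu r)%N -> (\sum_s mu s = m.+1)%N -> (\sum_s decr mu r s = m)%N.
Proof.
move=> mur; rewrite (bigD1 r) //= [in X in _ -> X](bigD1 r) //= /decr eqxx.
under [X in _ -> (_ + X)%N = _]eq_bigr => s sr do rewrite (negbTE sr) subn0.
lia.
Qed.

Section SumOverWords.
Variables (R : comNzRingType) (Q y : R) (n : nat).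
Implicit Type mu : 'I_n -> nat.

(* The multiset count matching word_sum: each r gets the positive and negative *)
(* levels still open at the stage (k, p).                                      *)
Definition level_prod (k p : nat) mu : R :=
  \prod_(r < n) signed_qhom Q y (mu r)
     (k + (letter_rank (r, false) < p)) (k + (letter_rank (r, true) < p)).

Definition word_sum (m k p : nat) mu : R :=
  \sum_(w in signed_perms mu m) chain_sum Q y k p w.

Lemma chain_sum_step k p (x : 'I_n * bool) w :
  chain_sum Q y k p.+1 (x :: w) = chain_sum Q y k p (x :: w) +
    (if letter_rank x == p then y ^+ x.2 * Q ^+ k * chain_sum Q y k p.+1 w else 0).
Proof.
rewrite /= ltnS leq_eqVlt; case: (ltngtP (letter_rank x) p) => [_|_|->] /=; rewrite ?addr0 //.
by rewrite addn1 addn0 big_ord_recr.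
Qed.

(** Admitting the pair (k, x) adds exactly the chains that begin with it. Deleting it leaves a chain
    that may begin with the same pair again, hence [p.+1] in the last term. *)
Lemma word_sum_step m k p mu (x : 'I_n * bool) : letter_rank x = p ->
  word_sum m.+1 k p.+1 mu = word_sum m.+1 k p mu +
   (if (0 < mu x.1)%N then y ^+ x.2 * Q ^+ k * word_sum m k p.+1 (decr mu x.1) else 0).
Proof.
move=> xp; rewrite /word_sum !big_tuple_cons.
under eq_bigr => u _.
  under eq_bigr => w _ do rewrite chain_sum_step.
  rewrite big_split; over.
rewrite big_split /=; congr (_ + _).
rewrite (bigD1 x) //= [X in _ + X]big1 ?addr0 => [|u ux]; last first.
  apply: big1 => w _; case: eqP => // up.
  by case/eqP: ux; apply: letter_rank_inj; rewrite xp.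
rewrite xp eqxx; under eq_bigl => w do rewrite signed_perms_cons.
case: (0 < mu x.1)%N => /=; last by rewrite big_pred0_eq.
by rewrite mulr_sumr.
Qed.

Lemma level_prod_step k p mu (x : 'I_n * bool) : letter_rank x = p ->
  level_prod k p.+1 mu = level_prod k p mu +
   (if (0 < mu x.1)%N then y ^+ x.2 * Q ^+ k * level_prod k p.+1 (decr mu x.1) else 0).
Proof.
move=> xp; rewrite /level_prod !(bigD1 (P := predT) x.1) //=.
have other r b : r != x.1 -> (letter_rank (r, b) < p.+1)%N = (letter_rank (r, b) < p)%N.
  move=> rx; rewrite ltnS leq_eqVlt -xp (inj_eq (@letter_rank_inj n)).
  by case: ((r, b) =P x) rx => // <-; rewrite eqxx.
have otherP (nu : 'I_n -> nat) : (forall r, r != x.1 -> nu r = mu r) ->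
  \prod_(r < n | r != x.1) signed_qhom Q y (nu r)
     (k + (letter_rank (r, false) < p.+1)) (k + (letter_rank (r, true) < p.+1)) =
  \prod_(r < n | r != x.1) signed_qhom Q y (mu r)
     (k + (letter_rank (r, false) < p)) (k + (letter_rank (r, true) < p)).
  by move=> numu; apply: eq_bigr => r rx; rewrite !other ?numu.
rewrite !otherP //; last by move=> r rx; rewrite /decr (negbTE rx) subn0.
set Z := \prod_(r < n | _) _.
have -> : decr mu x.1 x.1 = (mu x.1).-1 by rewrite /decr eqxx subn1.
case: (mu x.1) => [|d] /=; first by rewrite !signed_qhom0 addr0.
rewrite mulrA -mulrDl; congr (_ * _); rewrite -xp.
have opp : letter_rank (x.1, ~~ x.2) != letter_rank x.
  by rewrite (inj_eq (@letter_rank_inj n)); case: (x) => r b; rewrite xpair_eqE eqxx; case: b.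
have oppE : (letter_rank (x.1, ~~ x.2) < (letter_rank x).+1)%N
          = (letter_rank (x.1, ~~ x.2) < letter_rank x)%N.
  by rewrite ltnS leq_eqVlt (negbTE opp).
case: x {xp other otherP Z opp} oppE => r [] /= ->; rewrite !ltnSn !ltnn addn1 addn0.
  by rewrite signed_qhom_stepr expr1.
by rewrite signed_qhom_stepl expr0 mul1r.
Qed.

Lemma word_sum_next m k mu : word_sum m k.+1 0 mu = word_sum m k (n + n) mu.
Proof.
apply: eq_bigr => w _; case: (val w) => //= x s.
by rewrite letter_rank_bound addn0 addn1.
Qed.

Lemma level_prod_next k mu : level_prod k.+1 0 mu = level_prod k (n + n) mu.
Proof. by apply: eq_bigr => r _; rewrite !letter_rank_bound addn0 addn1. Qed.

Lemma word_sumE m k p mu : (\sum_r mu r)%N = m -> (p <= n + n)%N ->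
  word_sum m k p mu = level_prod k p mu.
Proof.
elim: m k p mu => [|m IHm] k p mu summ lep.
  have mu0 r : mu r = 0%N.
    by apply/eqP; rewrite -leqn0 -summ (bigD1 r) //= leq_addr.
  rewrite /level_prod big1 => [|r _]; last by rewrite mu0 signed_qhom0.
  rewrite /word_sum (big_pred1 [tuple]) // => w.
  rewrite [w]tuple0 inE [RHS]eqxx; apply/forallP => r; by rewrite mu0.
have climb k0 : word_sum m.+1 k0 0 mu = level_prod k0 0 mu ->
    forall j, (j <= n + n)%N -> word_sum m.+1 k0 j mu = level_prod k0 j mu.
  move=> base; elim=> [//|j IHj] ltj.
  have [x xj] := letter_rank_surj ltj.
  rewrite (word_sum_step _ _ _ xj) (level_prod_step _ _ xj) (IHj (ltnW ltj)).
  case: (boolP (0 < mu x.1)%N) => mux; last by [].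
  by rewrite IHm //; apply: sum_decr.
apply: (climb k _ p lep); elim: k => [|k IHk]; last first.
  by rewrite word_sum_next level_prod_next (climb k).
rewrite /word_sum big_tuple_cons big1 => [|x _]; last first.
  by apply: big1 => w _; rewrite /= big_ord0.
have /existsP[r mur] : [exists r, (0 < mu r)%N].
  apply: contra_eqT summ; rewrite negb_exists => /forallP mu0.
  by rewrite big1 // => r _; apply/eqP; rewrite -leqn0 leqNgt.
rewrite /level_prod (bigD1 r) //=; case: (mu r) mur => // d _.
by rewrite signed_qhom00 mul0r.
Qed.

End SumOverWords.

(** * The quotient and its specialization to Q = q^2, y = zq *)

Lemma signed_perms_series (F : fieldType) (Q y : F) n (mu : 'I_n -> nat) m :
    (\sum_(r < n) mu r)%N = m ->
  fps_div
    (fps_poly (\sum_(w in signed_perms mu m)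
       (Q ^+ maj (word_int w) * y ^+ negs (word_int w)) *: 'X^(des (word_int w))))
    (fps_poly (qpoch 'X Q%:P m.+1))
  =1 (fun k => level_prod Q y k n mu).
Proof.
move=> hm; apply: fps_div_unique => [|k].
  by rewrite /fps_poly qpoch_X_coef0 oner_neq0.
under eq_fps_mul => [j|j] do [over | rewrite -(word_sumE _ _ _ hm) ?leq_addr //; over].
rewrite /word_sum fps_mul_sumr /fps_poly coef_sum; apply: eq_bigr => w _.
rewrite -[in qpoch _ _ _](size_tuple w) (@chain_series _ _ _ _ 0) // => x.
exact: letter_rank_lt_n.
Qed.

Lemma level_prod_qbinom (F : fieldType) (Q y : F) n (mu : 'I_n -> nat) k :
    (forall i, Q ^+ i.+1 != 1) ->
  level_prod Q y k n mu =
  \prod_(r < n) \sum_(i < (mu r).+1)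
    y ^+ i * qbinom Q (Posz (mu r - i + k)) (mu r - i) * qbinom Q (Posz (i + k) - 1) i.
Proof.
move=> nQ; apply: eq_bigr => r _; apply: eq_bigr => i _.
rewrite !letter_rank_lt_n !letter_int_lt0 addn1 addn0.
rewrite (qhom_qbinom _ _ nQ); congr (_ * _); case: k => [|k].
  (* At k = 0 the negative letters have no level: i = 0 gives the convention [-1, 0] = 1, and i > 0
     gives [i - 1, i] = 0. *)
  rewrite addn0; case: (val i) => [|j] //.
  by rewrite (_ : Posz j.+1 - 1 = j); [rewrite /= big_ord0 ltnn | lia].
rewrite addnS (_ : Posz (i + k).+1 - 1 = Posz (i + k)); last by lia.
exact/esym/qhom_qbinom.
Qed.

(** The two sides differ in their constant coefficients. *)
Lemma q_expS_neq1 i : (q ^+ 2) ^+ i.+1 != 1.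
Proof.
rewrite -exprM /q -tofracXn -tofrac1 tofrac_eq; apply/eqP => /(congr1 (@mcoeff 2 rat 0%MM)).
rewrite mcoeff1 eqxx mpolyXn mcoeffX; case: eqP => [/mnmP/(_ 0) | _ /eqP].
  by rewrite mulmnE mnm1E mnm0E eqxx; lia.
by rewrite eq_sym oner_eq0.
Qed.

Theorem theorem3p2 (n : nat) (mu : 'I_n -> nat) (m : nat)
    (hn : (1 <= n)%N) (hmu : forall r : 'I_n, (0 < mu r)%N)
    (hm : (\sum_(r < n) mu r)%N = m) :
  fps_div
    (fps_poly (\sum_(w in signed_perms mu m)
       (q ^+ fmaj (word_int w) * z ^+ negs (word_int w))
         *: 'X^(des (word_int w))))
    (fps_poly (qpoch 'X (q ^+ 2)%:P m.+1))
  =1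
  (fun k : nat =>
     \prod_(r < n) \sum_(i < (mu r).+1)
        (z * q) ^+ i
        * qbinom (q ^+ 2) (Posz (mu r - i + k)) (mu r - i)
        * qbinom (q ^+ 2) (Posz (i + k) - 1) i).
Proof.
move=> k; rewrite -(level_prod_qbinom _ _ _ q_expS_neq1) -(signed_perms_series _ _ hm).
congr (fps_div (fps_poly _) _ k); apply: eq_bigr => w _; congr (_ *: _).
by rewrite /fmaj exprD exprM -mulrA -exprMn [q * z]mulrC.
Qed.
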